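(* Let $\mathcal{C}$ be a bounded above graded poset satisfying the standing assumptions listed in the context, and suppose there is an adequate covering family $\mathcal{J}$ for $\mathcal{C}$. Let $c_{\mathbb{Z}}:\mathcal{C}\to\mathrm{Ab}$ be the constant functor with value $\mathbb{Z}$. Then there is a sequence of functors $c_{\mathbb{Z}}=F_0,F_1,F_2,\dots$ in $\mathrm{Ab}^{\mathcal{C}}$, all of whose values are free abelian groups, such that for each $j\ge 1$ $$\varprojlim\nolimits^j c_{\mathbb{Z}}\cong\varprojlim\nolimits^1F_{j-1}.$$
   Context: A poset is regarded as a category with exactly one arrow $p\to p'$ when $p\le p'$; $p$ precedes $p'$ if $p<p'$ and there is nothing strictly in between. Standing assumptions on $\mathcal{C}$: it is a poset with a decreasing degree function $\deg:\mathrm{Ob}(\mathcal{C})\to\{0,1,2,\dots\}$, i.e. $\deg$ is strictly order reversing and $\deg(p')=\deg(p)-1$ whenever $p$ precedes $p'$ (such a graded poset is bounded above); some object has degree $0$; all maximal elements have the same degree (hence degree $0$); and for every object $i$ and every $n$ the set $(i\downarrow\mathcal{C})_n$ of objects $j\ge i$ with $\deg(j)=n$ is finite. $(i\downarrow\mathcal{C})_*$ denotes the full subcategory on the objects $j>i$. A covering family is a family $\mathcal{J}=\{J^{i_0}_p\}$ indexed by objects $i_0$ and integers $0\le p\le\deg(i_0)$, with $J^{i_0}_p\subseteq(i_0\downarrow\mathcal{C})_p$, such that for each $i_0$ and $0\le p<\deg(i_0)$: (a) $\bigcup_{i\in J^{i_0}_{p+1}}(i\downarrow\mathcal{C})_p=(i_0\downarrow\mathcal{C})_p$;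 (b) $J^i_p\subseteq J^{i_0}_p$ for every $i\in J^{i_0}_{p+1}$. Define integers $R^{i_0}_p$ for $\deg(i_0)\ge p\ge 0$ by $R^{i_0}_0=1$ and $R^{i_0}_p=\sum_{i\in(i_0\downarrow\mathcal{C})_{p-1}}R^i_{p-1}-R^{i_0}_{p-1}$ for $p\ge1$. The covering family $\mathcal{J}$ is adequate if $(i_0\downarrow\mathcal{C})_*$ is connected whenever $\deg(i_0)\ge2$, and $R^{i_0}_p=\sum_{i\in J^{i_0}_p}R^i_p$ for all $p\ge0$ and all $i_0$ with $\deg(i_0)\ge p+1$. $\varprojlim^j$ is the $j$-th right derived functor of $\varprojlim:\mathrm{Ab}^{\mathcal{C}}\to\mathrm{Ab}$. *)

(* Defs.v *)
From HB Require Import structures.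
From mathcomp Require Import all_boot all_order all_algebra.
From mathcomp Require Import boolp classical_sets functions cardinality fsbigop.
From Stdlib Require Import Relations.Relation_Operators.

Set Implicit Arguments.
Unset Strict Implicit.
Unset Printing Implicit Defensive.

Import Order.TTheory GRing.Theory Num.Theory.
Local Open Scope classical_set_scope.
Local Open Scope quotient_scope.
Local Open Scope ring_scope.

(** * Abelian groups *)

Definition zmod_iso (A B : zmodType) : Prop :=
  exists f : {additive A -> B}, bijective f.

(** [b] is a [Z]-basis: every element has a unique finite expansion on [b]. *)
Definition free_abelian (A : zmodType) : Prop :=
  exists (I : choiceType) (b : I -> A), forall x : A,
    exists! c : I -> int,
      finite_set [set i | c i != 0] /\ x = \sum_(i \in [set: I]) b i *~ c i.

Section KernelsAndCokernels.
Variables (A B : zmodType) (f : {additive A -> B}).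

Definition ker : {pred A} := fun x => f x == 0.

Lemma ker_zmod_closed : zmod_closed ker.
Proof.
split=> [|x y]; rewrite !unfold_in /ker ?raddf0 //.
by move=> /eqP fx /eqP fy; rewrite raddfB fx fy subr0.
Qed.
HB.instance Definition _ := GRing.isZmodClosed.Build A ker ker_zmod_closed.

Definition ker_type := {x : A | x \in ker}.
HB.instance Definition _ := SubChoice.on ker_type.
HB.instance Definition _ := [SubChoice_isSubZmodule of ker_type by <:].

Definition im : {pred B} := fun y => `[< exists x, f x = y >].

Lemma im_zmod_closed : zmod_closed im.
Proof.
split=> [|_ _ /asboolP[x <-] /asboolP[y <-]]; apply/asboolP.
  by exists 0; rewrite raddf0.
by exists (x - y); rewrite raddfB.
Qed.
HB.instance Definition _ := GRing.isZmodClosed.Build B im im_zmod_closed.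

Definition coker : zmodType := Quotient.quot im.
Definition coker_pi : {additive B -> coker} := \pi_coker.

Lemma coker_pi_surj (y : coker) : exists x, coker_pi x = y.
Proof. by exists (repr y); rewrite /coker_pi /= reprK. Qed.

Lemma coker_pi_eq0 (x : B) : coker_pi x = 0 <-> exists a, f a = x.
Proof.
have -> : (coker_pi x = 0) <-> x \in im.
  rewrite -[x in x \in _]subr0 Quotient.idealrBE -(raddf0 coker_pi).
  by split=> /eqP.
by split=> /asboolP.
Qed.

Section CokernelLift.
Variables (D : zmodType) (h : {additive B -> D}).
Hypothesis hf : forall x, h (f x) = 0.

Definition coker_lift_fun (y : coker) : D := h (repr y).

Lemma coker_lift_funE x : coker_lift_fun (coker_pi x) = h x.
Proof.
have [a fa] : exists a, f a = repr (coker_pi x) - x.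
  by apply/coker_pi_eq0; rewrite raddfB /coker_pi /= reprK subrr.
by apply/eqP; rewrite -subr_eq0 -raddfB -fa hf.
Qed.

Lemma coker_lift_is_additive : zmod_morphism coker_lift_fun.
Proof.
move=> y z; have [u <-] := coker_pi_surj y; have [v <-] := coker_pi_surj z.
by rewrite -raddfB !coker_lift_funE raddfB.
Qed.

Definition coker_lift : {additive coker -> D} :=
  HB.pack coker_lift_fun
    (GRing.isZmodMorphism.Build coker D coker_lift_fun coker_lift_is_additive).

Lemma coker_liftE x : coker_lift (coker_pi x) = h x.
Proof. exact: coker_lift_funE. Qed.

End CokernelLift.

End KernelsAndCokernels.

Section Cohomology.
Variables (X : nat -> zmodType) (d : forall n, {additive X n -> X n.+1}).

Definition is_coboundary n : X n -> Prop :=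
  match n with
  | 0 => fun y => y = 0
  | k.+1 => fun y => exists x, d k x = y
  end.

Definition coboundaries n : {pred ker_type (d n)} :=
  fun u => `[< is_coboundary (val u) >].

Lemma coboundaries_zmod_closed n : zmod_closed (@coboundaries n).
Proof.
split=> [|u v /asboolP + /asboolP +]; [apply/asboolP|move=> uB vB; apply/asboolP].
  by case: n => [|k] //=; exists 0; rewrite raddf0.
rewrite raddfB /=; case: n u v uB vB => [|k] u v /=.
  by move=> -> ->; rewrite subr0.
by case=> [x <-] [y <-]; exists (x - y); rewrite raddfB.
Qed.
HB.instance Definition _ n := GRing.isZmodClosed.Build (ker_type (d n))
  (@coboundaries n) (@coboundaries_zmod_closed n).

Definition cohomology n : zmodType := Quotient.quot (@coboundaries n).

End Cohomology.

(** * Functors from a poset to abelian groups *)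

Section Functors.
Context {disp : Order.disp_t} {C : porderType disp}.

Record functor := Functor {
  fobj :> C -> zmodType;
  fmap : forall i j : C, (i <= j)%O -> {additive fobj i -> fobj j};
  fmap_id : forall i (ii : (i <= i)%O) x, fmap ii x = x;
  fmap_comp : forall i j k (ij : (i <= j)%O) (jk : (j <= k)%O) (ik : (i <= k)%O) x,
    fmap ik x = fmap jk (fmap ij x) }.

Record nattrans (F G : functor) := NatTrans {
  nt_app :> forall i, {additive F i -> G i};
  nt_nat : forall i j (ij : (i <= j)%O) x,
    nt_app j (fmap F ij x) = fmap G ij (nt_app i x) }.

Program Definition const_functor (A : zmodType) : functor :=
  @Functor (fun=> A) (fun _ _ _ => idfun) _ _.

Record lim (F : functor) := Lim {
  lim_proj : forall i, F i;
  lim_compat : forall i j (ij : (i <= j)%O), fmap F ij (lim_proj i) = lim_proj j }.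

Lemma lim_ext F (x y : lim F) : (forall i, lim_proj x i = lim_proj y i) -> x = y.
Proof.
case: x y => [x xP] [y yP] /= xy.
have {}xy : x = y by exact: functional_extensionality_dep.
by case: _ / xy in yP *; congr Lim; exact: Prop_irrelevance.
Qed.

HB.instance Definition _ F := gen_eqMixin (lim F).
HB.instance Definition _ F := gen_choiceMixin (lim F).

Program Definition lim_zero F : lim F := @Lim F (fun=> 0) _.
Next Obligation. by rewrite raddf0. Qed.
Program Definition lim_opp F (x : lim F) : lim F :=
  @Lim F (fun i => - lim_proj x i) _.
Next Obligation. by rewrite raddfN lim_compat. Qed.
Program Definition lim_add F (x y : lim F) : lim F :=
  @Lim F (fun i => lim_proj x i + lim_proj y i) _.
Next Obligation. by rewrite raddfD !lim_compat. Qed.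

Fact lim_addA F : associative (@lim_add F).
Proof. by move=> x y z; apply: lim_ext => i /=; rewrite addrA. Qed.
Fact lim_addC F : commutative (@lim_add F).
Proof. by move=> x y; apply: lim_ext => i /=; rewrite addrC. Qed.
Fact lim_add0 F : left_id (lim_zero F) (@lim_add F).
Proof. by move=> x; apply: lim_ext => i /=; rewrite add0r. Qed.
Fact lim_addN F : left_inverse (lim_zero F) (@lim_opp F) (@lim_add F).
Proof. by move=> x; apply: lim_ext => i /=; rewrite addNr. Qed.
HB.instance Definition _ F := GRing.isZmodule.Build (lim F)
  (@lim_addA F) (@lim_addC F) (@lim_add0 F) (@lim_addN F).

Section LimMap.
Variables (F G : functor) (t : nattrans F G).
Program Definition lim_map_fun (x : lim F) : lim G :=
  @Lim G (fun i => t i (lim_proj x i)) _.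
Next Obligation. by rewrite -nt_nat lim_compat. Qed.

Lemma lim_map_is_additive : zmod_morphism lim_map_fun.
Proof. by move=> x y; apply: lim_ext => i /=; rewrite raddfB. Qed.
HB.instance Definition _ :=
  GRing.isZmodMorphism.Build (lim F) (lim G) lim_map_fun lim_map_is_additive.
Definition lim_map : {additive lim F -> lim G} := lim_map_fun.
End LimMap.

(** Monomorphisms and exactness in the functor category are objectwise. *)

Definition mono (F G : functor) (t : nattrans F G) : Prop :=
  forall i, injective (t i).

Definition exact_at (F G H : functor) (s : nattrans F G) (t : nattrans G H) :
  Prop := forall i (y : G i), t i y = 0 <-> exists x, s i x = y.

Definition injective_object (E : functor) : Prop :=
  forall (F G : functor) (m : nattrans F G) (a : nattrans F E), mono m ->
    exists b : nattrans G E, forall i x, b i (m i x) = a i x.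

Record injective_resolution (F : functor) := InjectiveResolution {
  res_obj :> nat -> functor;
  res_aug : nattrans F (res_obj 0);
  res_diff : forall n, nattrans (res_obj n) (res_obj n.+1);
  res_injective : forall n, injective_object (res_obj n);
  res_aug_mono : mono res_aug;
  res_exact0 : exact_at res_aug (res_diff 0);
  res_exactS : forall n, exact_at (res_diff n) (res_diff n.+1) }.

Definition lim_cohomology F (I : injective_resolution F) (j : nat) : zmodType :=
  cohomology (fun n => lim_map (res_diff I n)) j.

End Functors.
Arguments functor {disp} C.
Arguments injective_object {disp C} E.


(** * Enough injectives *)

(** A functional subgroup of [B * D], with [D] divisible, extends to the graph
    of a homomorphism. *)

Definition divisible (D : zmodType) : Prop :=
  forall n y, (0 < n)%N -> exists x : D, x *+ n = y.

Lemma pair_mulrz (B D : zmodType) (b : B) (y : D) (n : int) :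
  (b, y) *~ n = (b *~ n, y *~ n).
Proof.
have pM k : (b, y) *+ k = (b *+ k, y *+ k).
  by elim: k => [|k IH]; rewrite ?mulr0n// !mulrS IH.
by case: n => n; rewrite ?NegzE ?mulrNz -!pmulrn pM.
Qed.

Lemma int_subgroup (P : int -> Prop) :
  P 0 -> (forall n k, P n -> P k -> P (n - k)) ->
  exists m : nat, forall n, P n <-> (m %| n)%Z.
Proof.
move=> P0 PB.
have PN n : P n -> P (- n) by rewrite -sub0r; exact: PB.
have PD n k : P n -> P k -> P (n + k).
  by move=> Pn Pk; rewrite -[k]opprK; apply: PB => //; exact: PN.
have PM n k : P n -> P (k * n).
  move=> Pn; have Mn j : P (j%:Z * n).
    by elim: j => [|j IH]; rewrite ?mul0r// intS mulrDl mul1r; exact: PD.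
  by case: k => k; rewrite ?NegzE ?mulNr; [|apply: PN]; exact: Mn.
pose Q n := `[< (0 < n)%N /\ P n%:Z >].
have [exQ|nQ] := pselect (exists n, Q n); last first.
  exists 0%N => n; rewrite dvd0z; split=> [Pn|/eqP ->//].
  apply: contrapT => n0; apply: nQ; exists `|n|%N; apply/asboolP.
  split; first by rewrite absz_gt0; apply/negP.
  by case: n Pn {n0} => // n /PN; rewrite NegzE opprK.
case: (ex_minnP exQ) => m /asboolP[m0 Pm] minm; exists m => n.
split=> [Pn|/dvdzP[k ->]]; last exact: PM.
have mnz : m%:Z != 0 by rewrite -lt0n.
apply/dvdz_mod0P; apply: contrapT => r0.
have : P (n %% m%:Z)%Z by rewrite /modz; apply: PB => //; exact: PM.
have := ltz_pmod n (m0 : 0 < m%:Z); have := modz_ge0 n mnz.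
case: (n %% m%:Z)%Z r0 => [[|k]|//] //= _ _ km Pk.
have /minm : Q k.+1 by apply/asboolP.
by rewrite leqNgt -ltz_nat km.
Qed.

Section DivisibleExtension.
Variables (B D : zmodType) (divD : divisible D).

Let subgroup (G : set (B * D)) := forall p q, G p -> G q -> G (p - q).
Let functional (G : set (B * D)) := forall y, G (0, y) -> y = 0.

Variable G0 : set (B * D).
Hypotheses (G00 : G0 0) (G0B : subgroup G0) (G0f : functional G0).

(* The empty relation is allowed so that the empty chain has a bound. *)
Let partial (G : set (B * D)) :=
  [/\ subgroup G, functional G & G = set0 \/ G0 `<=` G].

Let partial_bigcup (F : set (set (B * D))) :
  F `<=` partial -> total_on F subset -> partial (\bigcup_(X in F) X).
Proof.
move=> FP totF; split.
- move=> p q [X FX Xp] [Y FY Yq].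
  have [XY|YX] := totF _ _ FX FY.
    by exists Y => //; have [sY _ _] := FP _ FY; apply: sY => //; apply: XY.
  by exists X => //; have [sX _ _] := FP _ FX; apply: sX => //; apply: YX.
- by move=> y [X FX Xy]; have [_ fX _] := FP _ FX; exact: fX.
- have [[X [FX X0]]|nX] := pselect (exists X, F X /\ X <> set0).
    have [_ _ [//|GX]] := FP _ FX.
    by right=> p /GX Xp; exists X.
  left; apply/seteqP; split=> // p [X FX Xp]; apply: nX; exists X; split=> //.
  by move=> X0; rewrite X0 in Xp.
Qed.

Let maximal_partial : exists G, [/\ G0 `<=` G, subgroup G, functional G &
  forall b, exists y, G (b, y)].
Proof.
have [G [[sG fG G0G] maxG]] := Zorn_bigcup partial_bigcup.
have {}G0G : G0 `<=` G.
  case: G0G => // Gempty; exfalso.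
  apply: (maxG G0).
    by split=> [|/(_ _ G00)]; rewrite Gempty.
  by split=> //; right.
exists G; split=> // b; apply: contrapT => nb.
have G1 := G0G _ G00.
have GN p : G p -> G (- p) by move=> Gp; rewrite -sub0r; exact: sG.
have GD p q : G p -> G q -> G (p + q).
  by move=> Gp Gq; rewrite -[q]opprK; apply: sG => //; exact: GN.
have GMn n p : G p -> G (p *+ n).
  by move=> Gp; elim: n => [|n IH]; rewrite ?mulr0n// mulrS; exact: GD.
have GMz (n : int) p : G p -> G (p *~ n).
  by move=> Gp; case: n => n; rewrite ?NegzE ?mulrNz; [|apply: GN]; exact: GMn.
have [||m mP] := @int_subgroup (fun n => exists y, G (b *~ n, y)).
- by exists 0.
- move=> n k [y Gy] [z Gz]; exists (y - z).
  by rewrite mulrzBr; exact: (sG _ _ Gy Gz).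
have [c cP] : exists c : D, forall (n : int) y, G (b *~ n, y) -> y = c *~ n.
  have [m0|m0] := posnP m.
    exists 0 => n y Gy; rewrite mul0rz; apply: fG.
    have /mP : exists y, G (b *~ n, y) by exists y.
    by rewrite m0 dvd0z => /eqP n0; rewrite n0 mulr0z in Gy.
  have [z Gz] : exists z, G (b *~ m, z) by apply/mP; exact: dvdzz.
  have [c cz] := divD z m0; exists c => n y Gy.
  have /mP/dvdzP[k nE] : exists y, G (b *~ n, y) by exists y.
  suff : G (0, y - z *~ k).
    by move/fG/eqP; rewrite subr_eq0 => /eqP ->; rewrite nE -cz mulrC mulrzA.
  have := sG _ _ Gy (GMz k _ Gz); rewrite pair_mulrz nE mulrC mulrzA.
  by congr G; congr pair; exact: subrr.
pose G' : set (B * D) := [set p | exists n : int, G (p - (b, c) *~ n)].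
have GG' : G `<=` G' by move=> p Gp; exists 0; rewrite mulr0z subr0.
apply: (maxG G').
  split=> // G'G; apply: nb; exists c; apply: G'G.
  by exists 1; rewrite mulr1z subrr.
split; last by right; exact: subset_trans GG'.
- move=> p q [n Gp] [k Gq]; exists (n - k).
  suff -> : p - q - (b, c) *~ (n - k) = p - (b, c) *~ n - (q - (b, c) *~ k).
    exact: sG.
  rewrite mulrzBr !opprB -!addrA; congr (p + _).
  by rewrite addrCA [RHS]addrC -addrA.
- move=> y [n Gy].
  have /cP /eqP : G (b *~ - n, y - c *~ n).
    by rewrite mulrNz -sub0r; move: Gy; rewrite pair_mulrz.
  by rewrite mulrNz subr_eq addNr => /eqP.
Qed.

Lemma divisible_extension :
  exists h : {additive B -> D}, forall b y, G0 (b, y) -> h b = y.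
Proof.
have [G [G0G sG fG /choice[h hP]]] := maximal_partial.
have hG b y : G (b, y) -> h b = y.
  move=> Gy; apply/eqP; rewrite -subr_eq0; apply/eqP; apply: fG.
  by have := sG _ _ (hP b) Gy; congr G; congr pair; rewrite /= subrr.
have hB : zmod_morphism h.
  by move=> x y; apply: hG; exact: (sG _ _ (hP x) (hP y)).
pose H := GRing.isZmodMorphism.Build B D h hB.
pose h' : {additive B -> D} := HB.pack h H.
by exists h' => b y /G0G; exact: hG.
Qed.

End DivisibleExtension.

Lemma divisible_injective (D A B : zmodType) (m : {additive A -> B})
    (a : {additive A -> D}) : divisible D -> injective m ->
  exists b : {additive B -> D}, forall x, b (m x) = a x.
Proof.
move=> divD minj.
pose G0 : set (B * D) := [set p | exists x, p = (m x, a x)].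
have [||| b bP] := @divisible_extension B D divD G0.
- by exists 0; rewrite !raddf0.
- by move=> _ _ [x ->] [y ->]; exists (x - y); rewrite !raddfB.
- move=> y [x [mx ->]]; have -> : x = 0 by apply: minj; rewrite raddf0.
  by rewrite raddf0.
by exists b => x; apply: bP; exists x.
Qed.

Definition QZ : zmodType := coker (intr : {additive int -> rat}).

Lemma QZ_divisible : divisible QZ.
Proof.
move=> n y n0; have [q <-] := coker_pi_surj y.
exists (coker_pi _ (q / n%:R)); rewrite -raddfMn; congr (coker_pi _ _).
rewrite -[LHS]mulr_natr divfK //.
by rewrite pnatr_eq0 -lt0n.
Qed.

Lemma QZ_cogenerator (A : zmodType) (x : A) :
  (forall f : {additive A -> QZ}, f x = 0) -> x = 0.
Proof.
move=> fx0; apply: contrapT => x0.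
have [||m mP] := @int_subgroup (fun n => x *~ n = 0); first by [].
  by move=> n k xn xk; rewrite mulrzBr xn xk subr0.
have [k [k1 kP]] : exists k : nat, (1 < k)%N /\
    forall n : int, x *~ n = 0 -> (k %| n)%Z.
  case: m mP => [|[|m]] mP; last by exists m.+2; split=> // n /mP.
    by exists 2%N; split=> // n /mP; rewrite dvd0z => /eqP ->; exact: dvdz0.
  by exfalso; apply: x0; rewrite -[x]mulr1z; apply/mP.
pose q := coker_pi (intr : {additive int -> rat}) k%:R^-1.
have k0 : k%:R != 0 :> rat by rewrite pnatr_eq0 -lt0n ltnW.
pose G0 : set (A * QZ) := [set p | exists n : int, p = (x *~ n, q *~ n)].
have [||| f fP] := @divisible_extension A QZ QZ_divisible G0.
- by exists 0.
- by move=> _ _ [n ->] [l ->]; exists (n - l); rewrite !mulrzBr.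
- move=> y [n [xn ->]]; have /esym/kP/dvdzP[l ->] := xn.
  rewrite -raddfMz /=; apply/coker_pi_eq0; exists l.
  by rewrite -mulrzr intrM mulrCA mulVf ?mulr1.
have : q = 0.
  by rewrite -(fx0 f) (fP x q) //; exists 1.
move/coker_pi_eq0 => [l lE].
have : l * k = 1.
  by apply: (@intr_inj rat); rewrite intrM lE mulVf.
move=> /(congr1 absz); rewrite abszM /= => /eqP; rewrite muln_eq1.
by case/andP => _ /eqP kE; rewrite kE in k1.
Qed.

(** [cofree F] sends [i] to the product of copies of [QZ] indexed by the pairs
    of an object [k >= i] and a homomorphism [F k -> QZ]. *)

Section EnoughInjectives.
Context {disp : Order.disp_t} {C : porderType disp}.
Implicit Types F : functor C.

Definition dual_pt F := {k : C & {additive F k -> QZ}}.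
Definition cofree_index F (i : C) := {p : dual_pt F | (i <= tag p)%O}.
Definition cofree_obj F (i : C) : zmodType := cofree_index F i -> QZ.

Definition reindex F i j (ij : (i <= j)%O) (p : cofree_index F j) :
    cofree_index F i :=
  exist _ (sval p) (le_trans ij (svalP p)).

Section CofreeMap.
Variables (F : functor C) (i j : C) (ij : (i <= j)%O).
Definition cofree_map_fun (g : cofree_obj F i) : cofree_obj F j :=
  fun p => g (reindex ij p).
Lemma cofree_map_is_additive : zmod_morphism cofree_map_fun.
Proof. by []. Qed.
HB.instance Definition _ := GRing.isZmodMorphism.Build
  (cofree_obj F i) (cofree_obj F j) cofree_map_fun cofree_map_is_additive.
Definition cofree_map : {additive cofree_obj F i -> cofree_obj F j} :=
  cofree_map_fun.
End CofreeMap.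

Lemma cofree_index_eq F i (p q : cofree_index F i) : sval p = sval q -> p = q.
Proof. by move=> pq; apply: val_inj. Qed.

Program Definition cofree F : functor C :=
  @Functor _ _ (cofree_obj F) (@cofree_map F) _ _.
Next Obligation.
by apply: funext => p; congr x; exact: cofree_index_eq.
Qed.
Next Obligation.
by apply: funext => p; congr x; exact: cofree_index_eq.
Qed.

Section CofreeUnit.
Variables (F : functor C) (i : C).
Definition cofree_unit_fun (x : F i) : cofree F i :=
  fun p => tagged (sval p) (fmap F (svalP p) x).
Lemma cofree_unit_is_additive : zmod_morphism cofree_unit_fun.
Proof. by move=> x y; apply: funext => p; rewrite /cofree_unit_fun !raddfB. Qed.
HB.instance Definition _ := GRing.isZmodMorphism.Build
  (F i) (cofree F i) cofree_unit_fun cofree_unit_is_additive.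
End CofreeUnit.

Program Definition cofree_unit F : nattrans F (cofree F) :=
  @NatTrans _ _ F (cofree F) (@cofree_unit_fun F) _.
Next Obligation.
apply: funext => p; rewrite /cofree_unit_fun /= /cofree_map_fun /=.
by rewrite -(fmap_comp ij (svalP p) (svalP (reindex ij p))).
Qed.

Lemma cofree_unit_mono F : mono (cofree_unit F).
Proof.
move=> i; apply: raddf_inj => x /= x0; apply: QZ_cogenerator => f.
have := congr1 (fun g => g (exist _ (Tagged _ f) (lexx i))) x0.
by rewrite /cofree_unit_fun /= fmap_id.
Qed.

Lemma cofree_injective F : injective_object (cofree F).
Proof.
move=> A B m a minj.
have ext (p : dual_pt F) : exists b : {additive B (tag p) -> QZ},
    forall x, b (m _ x) = a _ x (exist _ p (lexx _)).
  pose g x := a (tag p) x (exist _ p (lexx _)).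
  have gB : zmod_morphism g by move=> x y; rewrite /g raddfB.
  pose g' : {additive A (tag p) -> QZ} :=
    HB.pack g (GRing.isZmodMorphism.Build _ _ g gB).
  exact: (divisible_injective g' QZ_divisible (minj (tag p))).
pose b p := projT1 (cid (ext p)).
have bE p x : b p (m _ x) = a _ x (exist _ p (lexx _)) := projT2 (cid (ext p)) x.
pose h i (y : B i) : cofree F i := fun p => b (sval p) (fmap B (svalP p) y).
have hB i : zmod_morphism (h i).
  by move=> x y; apply: funext => p; rewrite /h !raddfB.
pose h' i : {additive B i -> cofree F i} :=
  HB.pack (h i) (GRing.isZmodMorphism.Build _ _ (h i) (hB i)).
have h_nat i j (ij : (i <= j)%O) x : h' j (fmap B ij x) = fmap (cofree F) ij (h' i x).
  apply: funext => p; rewrite /= /cofree_map_fun /h /=.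
  by rewrite -(fmap_comp ij (svalP p) (svalP (reindex ij p))).
exists (NatTrans h_nat) => i x; apply: funext => p /=.
rewrite /h -nt_nat bE nt_nat /= /cofree_map_fun; congr (a i x _).
exact: cofree_index_eq.
Qed.

Section CokerFunctor.
Variables (F G : functor C) (t : nattrans F G).

Lemma coker_map_subproof i j (ij : (i <= j)%O) (x : F i) :
  (coker_pi (t j) \o fmap G ij) (t i x) = 0.
Proof. by apply/coker_pi_eq0; exists (fmap F ij x); rewrite nt_nat. Qed.

Definition coker_map i j (ij : (i <= j)%O) : {additive coker (t i) -> coker (t j)} :=
  coker_lift (coker_map_subproof ij).

Lemma coker_mapE i j (ij : (i <= j)%O) x :
  coker_map ij (coker_pi _ x) = coker_pi _ (fmap G ij x).
Proof. exact: coker_liftE. Qed.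

Lemma coker_map_id i (ii : (i <= i)%O) x : coker_map ii x = x.
Proof. by have [y <-] := coker_pi_surj x; rewrite coker_mapE fmap_id. Qed.

Lemma coker_map_comp i j k (ij : (i <= j)%O) (jk : (j <= k)%O) (ik : (i <= k)%O) x :
  coker_map ik x = coker_map jk (coker_map ij x).
Proof.
have [y <-] := coker_pi_surj x.
by rewrite !coker_mapE (fmap_comp ij jk).
Qed.

Definition coker_functor : functor C := Functor coker_map_id coker_map_comp.

Definition coker_proj : nattrans G coker_functor :=
  @NatTrans _ _ G coker_functor (fun i => coker_pi (t i))
    (fun i j ij x => esym (coker_mapE ij x)).

End CokerFunctor.

Program Definition nt_comp (F G H : functor C) (s : nattrans F G)
    (t : nattrans G H) : nattrans F H :=
  @NatTrans _ _ F H (fun i => t i \o s i) _.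
Next Obligation. by rewrite /= !nt_nat. Qed.

Fixpoint cosyzygy F n : functor C :=
  if n is k.+1 then coker_functor (cofree_unit (cosyzygy F k)) else F.

Definition cofree_diff F n :
    nattrans (cofree (cosyzygy F n)) (cofree (cosyzygy F n.+1)) :=
  nt_comp (coker_proj (cofree_unit (cosyzygy F n)))
          (cofree_unit (cosyzygy F n.+1)).

Lemma cofree_diff_eq0 F n i x :
  cofree_diff F n i x = 0 <-> exists y, cofree_unit (cosyzygy F n) i y = x.
Proof.
rewrite -coker_pi_eq0; split=> [x0|/= ->]; last by rewrite raddf0.
by apply: (@cofree_unit_mono (cosyzygy F n.+1) i); rewrite raddf0.
Qed.

Definition cofree_resolution F : injective_resolution F.
Proof.
apply: (@InjectiveResolution _ _ F (fun n => cofree (cosyzygy F n))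
  (cofree_unit F) (@cofree_diff F)) => [n|||n i x].
- exact: cofree_injective.
- exact: cofree_unit_mono.
- exact: cofree_diff_eq0.
rewrite cofree_diff_eq0; split=> [[y <-]|[y <-]].
  by have [z <-] := coker_pi_surj y; exists z.
by exists (coker_pi _ y).
Defined.

(** The right derived functors of the limit, computed on a chosen injective
    resolution; any other one gives isomorphic groups. *)

Definition Rlim (j : nat) F : zmodType := lim_cohomology (cofree_resolution F) j.

End EnoughInjectives.

(** * Graded posets and covering families *)

Section GradedPosets.
Context {disp : Order.disp_t} {C : porderType disp}.
Implicit Types (i j p q : C) (n : nat).

Definition precedes p q : Prop :=
  (p < q)%O /\ ~ exists r, (p < r)%O /\ (r < q)%O.

Definition maximal p : Prop := ~ exists q, (p < q)%O.

Record decreasing_degree (deg : C -> nat) : Prop := DecreasingDegree {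
  deg_lt : forall p q, (p < q)%O -> (deg q < deg p)%N;
  deg_precedes : forall p q, precedes p q -> deg p = (deg q).+1 }.

Variable deg : C -> nat.

Definition up i n : set C := [set j | (i <= j)%O /\ deg j = n].

Record standing_assumptions : Prop := StandingAssumptions {
  decreasing_deg : decreasing_degree deg;
  deg0_nonempty : exists i, deg i = 0%N;
  deg_maximal : forall i j, maximal i -> maximal j -> deg i = deg j;
  up_finite : forall i n, finite_set (up i n) }.

(** A full subcategory of a poset is connected if it is nonempty and any two of
    its objects are joined by a zigzag of arrows in it. *)

Definition connected_subposet (S : set C) : Prop :=
  S !=set0 /\ forall p q, S p -> S q ->
    clos_refl_sym_trans C (fun x y => [/\ S x, S y & (x <= y)%O]) p q.

Definition strict_up i : set C := [set j | (i < j)%O].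

(** The values [J i n] and [Rnum n i] with [n > deg i] are never used. *)

Record covering_family (J : C -> nat -> set C) : Prop := CoveringFamily {
  covering_sub : forall i n, (n <= deg i)%N -> J i n `<=` up i n;
  covering_union : forall i n, (n < deg i)%N ->
    \bigcup_(j in J i n.+1) up j n = up i n;
  covering_mono : forall i n, (n < deg i)%N ->
    forall j, J i n.+1 j -> J j n `<=` J i n }.

Fixpoint Rnum n i : int :=
  if n is k.+1 then \sum_(j \in up i k) Rnum k j - Rnum k i else 1.

Record adequate (J : C -> nat -> set C) : Prop := Adequate {
  adequate_connected : forall i, (2 <= deg i)%N ->
    connected_subposet (strict_up i);
  adequate_Rnum : forall n i, (n < deg i)%N ->
    Rnum n i = \sum_(j \in J i n) Rnum n j }.

End GradedPosets.

(* Main.v *)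
Require Import Defs.
From HB Require Import structures.
From mathcomp Require Import all_boot all_order all_algebra.
From mathcomp Require Import boolp classical_sets cardinality fsbigop functions.

Set Implicit Arguments.
Unset Strict Implicit.
Unset Printing Implicit Defensive.

Import Order.TTheory GRing.Theory.
Local Open Scope classical_set_scope.
Local Open Scope quotient_scope.
Local Open Scope ring_scope.

(** Every [{k | k >= i}] is finite, so [G F i = \prod_(k >= i) F k] (the functor
    [coind F]) is a finite product. The unit [F -> G F] is objectwise split by the
    factor [k = i], so its cokernel is [i |-> \prod_(k > i) F k], free when [F]
    is; iterating gives the sequence.

    It remains to see [lim^(n+1) (G F / F) = lim^(n+2) F]. Embedding each
    [F k] in a divisible group [D k] with divisible quotient [B k], we get an exact
    [0 -> G F -> G D -> G B -> 0] with [G D], [G B] injective and [lim G D]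
    mapping onto [lim G B]. Put [S = G D / F], a cosyzygy of [F]. Then
    [0 -> G F / F -> S -> G B -> 0] is exact with injective quotient and surjective
    on limits, so [G F / F] and [S] have the same higher limits. Cosyzygies along
    different injectives are compared up to maps that factor through injectives. *)

(** * Isomorphisms, cokernels and finite free abelian groups *)

Section AbelianGroups.
Implicit Types A B D : zmodType.

Definition additive_of A B (f : A -> B) (fB : zmod_morphism f) :
    {additive A -> B} :=
  HB.pack f (GRing.isZmodMorphism.Build A B f fB).

Lemma zmod_iso_bij A B (f : {additive A -> B}) :
  injective f -> (forall y, exists x, f x = y) -> zmod_iso A B.
Proof.
by move=> finj /choice[g gK]; exists f; exists g => // x; apply: finj; rewrite gK.
Qed.

Lemma zmod_iso_refl A : zmod_iso A A.
Proof. by exists idfun; exists id. Qed.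

Lemma zmod_iso_sym A B : zmod_iso A B -> zmod_iso B A.
Proof.
case=> f [g fK gK].
have gB : zmod_morphism g.
  by move=> x y; apply: (can_inj fK); rewrite raddfB !gK.
by exists (additive_of gB); exists f.
Qed.

Lemma zmod_iso_trans A B D : zmod_iso A B -> zmod_iso B D -> zmod_iso A D.
Proof.
by move=> [f fbij] [g gbij]; exists (g \o f); exact: bij_comp.
Qed.

Lemma coker_iso A B D (f : {additive A -> B}) (h : {additive B -> D}) :
  (forall y, exists x, h x = y) ->
  (forall x, h x = 0 <-> exists a, f a = x) -> zmod_iso (coker f) D.
Proof.
move=> hsurj hker.
have hf a : h (f a) = 0 by apply/hker; exists a.
apply: (@zmod_iso_bij _ _ (coker_lift hf)).
  apply: raddf_inj => y; have [x <-] := coker_pi_surj y.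
  by rewrite coker_liftE => /hker; exact: (coker_pi_eq0 f x).2.
by move=> y; have [x <-] := hsurj y; exists (coker_pi f x); rewrite coker_liftE.
Qed.

(** The first two conditions let [u] and [v] descend to the cokernels; the last two make the
    descended maps mutually inverse. *)
Lemma coker_iso_homotopy A B A' B' (f : {additive A -> B})
    (f' : {additive A' -> B'}) (u : {additive B -> B'}) (v : {additive B' -> B}) :
  (forall a, exists a', f' a' = u (f a)) ->
  (forall a', exists a, f a = v (f' a')) ->
  (forall b, exists a, f a = v (u b) - b) ->
  (forall b', exists a', f' a' = u (v b') - b') ->
  zmod_iso (coker f) (coker f').
Proof.
move=> fu fv vu uv; apply: (@coker_iso _ _ _ _ (coker_pi f' \o u)) => /=.
  move=> y; have [b' <-] := coker_pi_surj y; exists (v b').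
  by apply/eqP; rewrite -subr_eq0 -raddfB; apply/eqP/coker_pi_eq0; exact: uv.
move=> b; rewrite coker_pi_eq0; split=> [[a' ub]|[a <-]]; last exact: fu.
have [a va] := fv a'; have [c vub] := vu b.
by exists (a - c); rewrite raddfB va vub ub subKr.
Qed.

(** Free of finite rank: on a finite [T] every integer function has finite support. Coordinates,
    unlike a basis, arise from a single map out of a cokernel. *)
Definition free_fin A :=
  exists (T : finType) (f : {additive A -> (T -> int)}), bijective f.

Lemma free_fin_iso A B : zmod_iso A B -> free_fin B -> free_fin A.
Proof.
by move=> [f fbij] [T [g gbij]]; exists T, (g \o f); exact: bij_comp.
Qed.

Lemma free_fin_int : free_fin int.
Proof.
have fB : zmod_morphism (fun (n : int) (_ : unit) => n) by [].
exists unit, (additive_of fB); exists (fun g => g tt) => // g.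
by apply: funext; case.
Qed.

Lemma free_fin_free A : free_fin A -> free_abelian A.
Proof.
case=> T [f [g fK gK]].
(* The basis consists of the preimages of the indicator functions, and [f x] lists the coordinates
   of [x]. *)
pose delta (t : T) : T -> int := fun s => (s == t)%:R.
exists T, (g \o delta) => x.
have evB t : zmod_morphism (fun h : T -> int => h t) by [].
pose ev t := additive_of (evB t).
have sumE (c : T -> int) : f (\sum_(i \in [set: T]) (g \o delta) i *~ c i) = c.
  apply: funext => t; rewrite -[LHS]/((ev t \o f) _).
  have evg i : (ev t \o f) ((g \o delta) i) = (t == i)%:R by rewrite /= gK.
  rewrite (@fsbigE _ _ _ _ _ (index_enum T)) ?index_enum_uniq//; last first.
    by move=> i; rewrite mem_index_enum.
  rewrite (eq_bigl xpredT) => [|i]; last by rewrite in_setT.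
  rewrite raddf_sum (eq_bigr (fun i => (t == i)%:R *~ c i)) => [|i _]; last first.
    by rewrite raddfMz; congr (_ *~ _); exact: evg.
  rewrite (bigD1 t)//= eqxx intz big1 ?addr0// => i it.
  by rewrite eq_sym (negbTE it) mul0rz.
exists (f x); split; first split.
- exact: finite_finset.
- by apply: (can_inj fK); rewrite sumE.
- by move=> c [_ ->]; rewrite sumE.
Qed.

End AbelianGroups.

(** * Short exact sequences of functors *)

Section Functors.
Context {disp : Order.disp_t} {C : porderType disp}.
Implicit Types E F G H I X Y : functor C.

Definition nt_of F G (f : forall i, F i -> G i)
    (fB : forall i, zmod_morphism (f i))
    (fN : forall i j (ij : (i <= j)%O) x, f j (fmap F ij x) = fmap G ij (f i x)) :
    nattrans F G :=
  @NatTrans _ _ F G (fun i => additive_of (fB i)) fN.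

Program Definition nt_id F : nattrans F F := @NatTrans _ _ F F (fun=> idfun) _.

Lemma nt_sub_is_additive F G (f g : nattrans F G) i :
  zmod_morphism (fun x => f i x - g i x).
Proof.
move=> x y; rewrite (raddfB (f i)) (raddfB (g i)) !opprB addrACA [RHS]addrACA.
by congr (_ + _); exact: addrC.
Qed.

Program Definition nt_sub F G (f g : nattrans F G) : nattrans F G :=
  nt_of (@nt_sub_is_additive F G f g) _.
Next Obligation. by rewrite !nt_nat raddfB. Qed.

Definition epi F G (q : nattrans F G) : Prop := forall i y, exists x, q i x = y.

Record short_exact F G H (m : nattrans F G) (q : nattrans G H) : Prop :=
  ShortExact { se_mono : mono m; se_exact : exact_at m q; se_epi : epi q }.

Lemma se_comp F G H (m : nattrans F G) (q : nattrans G H) i x :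
  short_exact m q -> q i (m i x) = 0.
Proof. by move=> mq; apply/(se_exact mq); exists x. Qed.

Lemma coker_short_exact F G (m : nattrans F G) :
  mono m -> short_exact m (coker_proj m).
Proof.
by move=> minj; split=> // i y; [exact: coker_pi_eq0|exact: coker_pi_surj].
Qed.

(** An objectwise section [s] of [q] need be neither additive nor natural, but [h] kills the kernel
    of [q], so [h] after [s] is both. *)
Lemma nt_factor X Y H (q : nattrans X Y) (h : nattrans X H) :
  epi q -> (forall i x, q i x = 0 -> h i x = 0) ->
  exists h' : nattrans Y H, forall i x, h' i (q i x) = h i x.
Proof.
move=> qepi qh; pose s i y := projT1 (cid (qepi i y)).
have sK i y : q i (s i y) = y := projT2 (cid (qepi i y)).
have hE i x x' : q i x = q i x' -> h i x = h i x'.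
  move=> qx; apply/eqP; rewrite -subr_eq0 -raddfB; apply/eqP/qh.
  by rewrite raddfB qx subrr.
have hB i : zmod_morphism (fun y => h i (s i y)).
  by move=> x y; rewrite -raddfB; apply: hE; rewrite raddfB !sK.
have hN i j (ij : (i <= j)%O) x :
    h j (s j (fmap Y ij x)) = fmap H ij (h i (s i x)).
  by rewrite -nt_nat; apply: hE; rewrite nt_nat !sK.
by exists (nt_of hB hN) => i x; apply: hE; rewrite sK.
Qed.

Lemma nt_factor_exact F G H X (m : nattrans F G) (q : nattrans G H)
    (h : nattrans G X) :
  short_exact m q -> (forall i x, h i (m i x) = 0) ->
  exists h' : nattrans H X, forall i x, h' i (q i x) = h i x.
Proof.
move=> mq hm; apply: nt_factor; first exact: se_epi mq.
by move=> i x /(se_exact mq)[y <-].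
Qed.

(** * Stable equivalence: isomorphism modulo maps that factor through injectives *)

Definition factors_injective X Y (f : nattrans X Y) : Prop :=
  exists E (a : nattrans X E) (b : nattrans E Y),
    injective_object E /\ forall i x, f i x = b i (a i x).

Definition stable_equiv X Y : Prop :=
  exists (f : nattrans X Y) (g : nattrans Y X),
    factors_injective (nt_sub (nt_comp f g) (nt_id X)) /\
    factors_injective (nt_sub (nt_comp g f) (nt_id Y)).

Lemma nt_lift X I Y X' I' Y' (m : nattrans X I) (q : nattrans I Y)
    (m' : nattrans X' I') (q' : nattrans I' Y') (f : nattrans X X') :
  short_exact m q -> short_exact m' q' -> injective_object I' ->
  exists (f0 : nattrans I I') (f1 : nattrans Y Y'),
    (forall i x, f0 i (m i x) = m' i (f i x)) /\
    (forall i x, f1 i (q i x) = q' i (f0 i x)).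
Proof.
move=> mq mq' I'inj.
have [f0 f0E] := I'inj _ _ _ (nt_comp f m') (se_mono mq).
have [|f1 f1E] := @nt_factor_exact _ _ _ _ _ _ (nt_comp f0 q') mq.
  by move=> i x /=; rewrite f0E /= se_comp.
by exists f0, f1.
Qed.

(** Extend [a] along [m] to [c]. Then [e0 - id - m b c] vanishes on [X], so it factors through [q]
    as [t]; composing with [q] kills the term [m b c]. *)
Lemma cosyzygy_homotopy X I Y (m : nattrans X I) (q : nattrans I Y)
    (e : nattrans X X) (e0 : nattrans I I) (e1 : nattrans Y Y) :
  short_exact m q -> factors_injective (nt_sub e (nt_id X)) ->
  (forall i x, e0 i (m i x) = m i (e i x)) ->
  (forall i x, e1 i (q i x) = q i (e0 i x)) ->
  exists t : nattrans Y I, forall i y, e1 i y - y = q i (t i y).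
Proof.
move=> mq [E [a [b [Einj eE]]]] e0E e1E.
have [c cE] := Einj _ _ _ a (se_mono mq).
pose h := nt_sub (nt_sub e0 (nt_id I)) (nt_comp c (nt_comp b m)).
have [|t tE] := @nt_factor_exact _ _ _ _ _ _ h mq.
  by move=> i x /=; rewrite e0E cE -eE /= raddfB subrr.
exists t => i y; have [x <-] := se_epi mq y.
by rewrite tE /= e1E 2!raddfB /= (se_comp _ mq) subr0.
Qed.

(** The homotopies serve twice: they factor the differences through the injectives [I] and [I'], and
    on limits they put them in the images of [q] and [q']. *)
Lemma stable_equiv_homotopy X I Y X' I' Y' (m : nattrans X I) (q : nattrans I Y)
    (m' : nattrans X' I') (q' : nattrans I' Y') :
  short_exact m q -> short_exact m' q' ->
  injective_object I -> injective_object I' -> stable_equiv X X' ->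
  exists (f0 : nattrans I I') (f1 : nattrans Y Y') (g0 : nattrans I' I)
    (g1 : nattrans Y' Y) (t : nattrans Y I) (t' : nattrans Y' I'),
    [/\ forall i x, f1 i (q i x) = q' i (f0 i x),
        forall i x, g1 i (q' i x) = q i (g0 i x),
        forall i y, g1 i (f1 i y) - y = q i (t i y) &
        forall i y, f1 i (g1 i y) - y = q' i (t' i y)].
Proof.
move=> mq mq' Iinj I'inj [f [g [gf fg]]].
have [f0 [f1 [f0E f1E]]] := nt_lift f mq mq' I'inj.
have [g0 [g1 [g0E g1E]]] := nt_lift g mq' mq Iinj.
have [||t tE] := cosyzygy_homotopy (e0 := nt_comp f0 g0) (e1 := nt_comp f1 g1) mq gf.
- by move=> i x /=; rewrite f0E g0E.
- by move=> i x /=; rewrite f1E g1E.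
have [||t' t'E] := cosyzygy_homotopy (e0 := nt_comp g0 f0) (e1 := nt_comp g1 f1) mq' fg.
- by move=> i x /=; rewrite g0E f0E.
- by move=> i x /=; rewrite g1E f1E.
by exists f0, f1, g0, g1, t, t'.
Qed.

Lemma stable_equiv_cosyzygy X I Y X' I' Y' (m : nattrans X I)
    (q : nattrans I Y) (m' : nattrans X' I') (q' : nattrans I' Y') :
  short_exact m q -> short_exact m' q' ->
  injective_object I -> injective_object I' ->
  stable_equiv X X' -> stable_equiv Y Y'.
Proof.
move=> mq mq' Iinj I'inj XX'.
have [f0 [f1 [g0 [g1 [t [t' [f1E g1E tE t'E]]]]]]] :=
  stable_equiv_homotopy mq mq' Iinj I'inj XX'.
by exists f1, g1; split; [exists I, t, q|exists I', t', q'].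
Qed.

Lemma lim_coker_stable X I Y X' I' Y' (m : nattrans X I) (q : nattrans I Y)
    (m' : nattrans X' I') (q' : nattrans I' Y') :
  short_exact m q -> short_exact m' q' ->
  injective_object I -> injective_object I' -> stable_equiv X X' ->
  zmod_iso (coker (lim_map q)) (coker (lim_map q')).
Proof.
move=> mq mq' Iinj I'inj XX'.
have [f0 [f1 [g0 [g1 [t [t' [f1E g1E tE t'E]]]]]]] :=
  stable_equiv_homotopy mq mq' Iinj I'inj XX'.
apply: (@coker_iso_homotopy _ _ _ _ _ _ (lim_map f1) (lim_map g1)) => y.
- by exists (lim_map f0 y); apply: lim_ext => i /=; rewrite f1E.
- by exists (lim_map g0 y); apply: lim_ext => i /=; rewrite g1E.
- by exists (lim_map t y); apply: lim_ext => i /=; rewrite -tE.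
- by exists (lim_map t' y); apply: lim_ext => i /=; rewrite -t'E.
Qed.

Lemma stable_equiv_refl X E : injective_object E -> stable_equiv X X.
Proof.
have zB F i : zmod_morphism (fun _ : F i => 0 : E i) by move=> x y; rewrite subr0.
have zB' F i : zmod_morphism (fun _ : E i => 0 : F i) by move=> x y; rewrite subr0.
have zN F i j (ij : (i <= j)%O) (x : F i) : 0 = fmap E ij 0 by rewrite raddf0.
have zN' F i j (ij : (i <= j)%O) (x : E i) : 0 = fmap F ij 0 by rewrite raddf0.
move=> Einj; exists (nt_id X), (nt_id X).
(* Both differences are zero, and the zero map factors through [E]. *)
by split; exists E, (nt_of (zB X) (zN X)), (nt_of (zB' X) (zN' X));
  split=> // i x /=; rewrite subrr.
Qed.

(** * Higher limits as cokernels on limits, and dimension shifting *)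

(** [Lcok n F] is [lim^(n+1) F], see [Rlim_Lcok]. *)
Definition Lcok n F : zmodType :=
  coker (lim_map (coker_proj (cofree_unit (cosyzygy F n)))).

(** Left exactness of the limit: as [m] is mono, the objectwise preimages are unique, hence
    compatible. *)
Lemma lim_exact F G H (m : nattrans F G) (q : nattrans G H) (y : lim G) :
  mono m -> exact_at m q -> lim_map q y = 0 -> exists x, lim_map m x = y.
Proof.
move=> minj mq qy.
have ex i : exists x, m i x = lim_proj y i.
  by apply/mq; rewrite -[LHS]/(lim_proj (lim_map q y) i) qy.
pose x i := projT1 (cid (ex i)).
have xE i : m i (x i) = lim_proj y i := projT2 (cid (ex i)).
have xC i j (ij : (i <= j)%O) : fmap F ij (x i) = x j.
  by apply: minj; rewrite nt_nat !xE lim_compat.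
by exists (Lim xC); apply: lim_ext => i /=; rewrite xE.
Qed.

(** By left exactness the cocycles in degree [n+1] are the limit of the cosyzygy [S]; the
    coboundaries are the image of the limit of the preceding injective. *)
Lemma Rlim_Lcok n F : zmod_iso (Rlim n.+1 F) (Lcok n F).
Proof.
apply: zmod_iso_sym.
set S := cosyzygy F n.+1; pose d := lim_map (cofree_diff F n.+1).
pose u := lim_map (cofree_unit S).
have u0 y : u y \in ker d.
  apply/eqP; apply: lim_ext => i; apply/(@cofree_diff_eq0 _ _ F n.+1 i).
  by exists (lim_proj y i).
pose h y : Rlim n.+1 F := \pi_(Rlim n.+1 F) (Sub (u y) (u0 y) : ker_type d).
have hB : zmod_morphism h.
  move=> x y; rewrite /h -raddfB; congr (\pi _).
  by apply: val_inj; rewrite /= raddfB.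
apply: (@coker_iso _ _ _ _ (additive_of hB)) => [y|y] /=.
  have [z zE] : exists z, u z = val (repr y).
    apply: lim_exact (cofree_unit_mono (F := S)) (@cofree_diff_eq0 _ _ _ _) _.
    by have /eqP := valP (repr y).
  exists z; rewrite /h -[RHS]reprK; congr (\pi _); exact: val_inj.
have uinj : injective u.
  move=> x z xz; apply: lim_ext => i; apply: (@cofree_unit_mono _ _ S i).
  by have /= := congr1 (fun w : lim (cofree S) => lim_proj w i) xz.
have h0 : (h y = 0) <-> exists a, lim_map (cofree_diff F n) a = u y.
  (* Writing the zero class as [h 0] turns equality of classes into membership of a difference in
     the coboundaries. *)
  rewrite -(raddf0 (additive_of hB)) /= /h.
  pose w x : ker_type d := Sub (u x) (u0 x).
  have wE : val (w y - w 0) = u y by rewrite raddfB /= raddf0 subr0.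
  rewrite (rwP eqP) -Quotient.idealrBE.
  split=> [/asboolP[a ay]|[a ay]]; first by exists a; exact: etrans ay wE.
  by apply/asboolP; exists a; exact: etrans ay (esym wE).
rewrite h0; split=> [[a ay]|[a <-]]; exists a.
  apply: uinj; rewrite -ay; apply: lim_ext => i //.
by apply: lim_ext.
Qed.

Lemma cosyzygySr n F : cosyzygy F n.+1 = cosyzygy (cosyzygy F 1) n.
Proof. by elim: n => //= n <-. Qed.

Lemma cosyzygy_short_exact n F :
  short_exact (cofree_unit (cosyzygy F n)) (coker_proj (cofree_unit (cosyzygy F n))).
Proof. exact: coker_short_exact (@cofree_unit_mono _ _ _). Qed.

Lemma Lcok_stable n X Y : stable_equiv X Y -> zmod_iso (Lcok n X) (Lcok n Y).
Proof.
move=> XY; have {}XY : stable_equiv (cosyzygy X n) (cosyzygy Y n).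
  elim: n => // n IH.
  by apply: stable_equiv_cosyzygy (cosyzygy_short_exact n X)
    (cosyzygy_short_exact n Y) _ _ IH; exact: cofree_injective.
by apply: lim_coker_stable (cosyzygy_short_exact n X)
  (cosyzygy_short_exact n Y) _ _ XY; exact: cofree_injective.
Qed.

Lemma Lcok0_resolution X I Y (m : nattrans X I) (q : nattrans I Y) :
  short_exact m q -> injective_object I ->
  zmod_iso (Lcok 0 X) (coker (lim_map q)).
Proof.
move=> mq Iinj; have XX := stable_equiv_refl X Iinj.
by apply: lim_coker_stable (cosyzygy_short_exact 0 X) mq _ Iinj XX;
  exact: cofree_injective.
Qed.

(** Dimension shifting along any injective embedding: [Y] is stably equivalent to the first cofree
    cosyzygy of [X]. *)
Lemma Lcok_shift n X I Y (m : nattrans X I) (q : nattrans I Y) :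
  short_exact m q -> injective_object I ->
  zmod_iso (Lcok n.+1 X) (Lcok n Y).
Proof.
move=> mq Iinj; rewrite /Lcok cosyzygySr; apply: (@Lcok_stable n).
have XX := stable_equiv_refl X Iinj.
by apply: stable_equiv_cosyzygy (cosyzygy_short_exact 0 X) mq _ Iinj XX;
  exact: cofree_injective.
Qed.

(** * Subobjects with injective quotient, surjective on limits *)

(** With [u : S -> I] the unit, the quotient [R = I / K] is an extension of
    [I / S] by [Q]; it splits as [Q] is injective. *)
Lemma Lcok_injective_quotient n K S Q (k : nattrans K S) (w : nattrans S Q) :
  short_exact k w -> injective_object Q ->
  (forall y, exists x, lim_map w x = y) -> zmod_iso (Lcok n K) (Lcok n S).
Proof.
move=> kw Qinj wlim; pose u := cofree_unit S; pose qS := coker_proj u.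
have uq : short_exact u qS := cosyzygy_short_exact 0 S.
have uinj : mono u := se_mono uq.
have ukinj : mono (nt_comp k u) by move=> i x y /uinj /(se_mono kw).
have ukq := coker_short_exact ukinj.
set qR := coker_proj (nt_comp k u) in ukq.
(* The sequence to split is [0 -> Q -> R -> I / S -> 0], with maps [a] and [p]. *)
have [|p pE] := @nt_factor_exact _ _ _ _ _ _ qS ukq.
  by move=> i x; exact: (se_comp _ uq).
have [|a aE] := @nt_factor_exact _ _ _ _ _ _ (nt_comp u qR) kw.
  by move=> i x; exact: (se_comp _ ukq).
have ainj : mono a.
  move=> i; apply: raddf_inj => y; have [x <-] := se_epi kw y.
  rewrite aE /= => /(se_exact ukq)[z /uinj <-]; exact: (se_comp _ kw).
have pa i y : p i (a i y) = 0.
  by have [x <-] := se_epi kw y; rewrite aE /= pE; exact: (se_comp _ uq).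
have [r rE] := Qinj _ _ _ (nt_id Q) ainj.
(* Since [r] retracts [a], the map [id - a r] kills the kernel of [p], which is the image of [a]; it
   induces a section [s] of [p] with [s p = id - a r]. *)
have [|x|s sE] := @nt_factor _ _ _ p (nt_sub (nt_id _) (nt_comp r a)).
- move=> i y; have [x <-] := se_epi uq y.
  by exists (qR i x); rewrite pE.
- move=> y; have [z <-] := se_epi ukq y.
  rewrite pE => /(se_exact uq)[v <-] /=.
  by rewrite -[qR _ _]/((nt_comp u qR) _ v) -aE rE /= subrr.
have ps i y : p i (s i y) = y.
  have [x <-] := se_epi uq y.
  by rewrite -pE sE /= raddfB /= pa subr0.
have I0inj : injective_object (cofree S) by exact: cofree_injective.
case: n => [|n].
  apply: zmod_iso_trans (Lcok0_resolution ukq I0inj) _.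
  (* Surjectivity of [w] on limits makes the contribution of [Q] vanish in the cokernel. *)
  have alim y : exists x, lim_map qR x = lim_map a y.
    have [x <-] := wlim y; exists (lim_map u x).
    by apply: lim_ext => i /=; rewrite aE.
  apply: (@coker_iso_homotopy _ _ _ _ _ _ (lim_map p) (lim_map s)) => y.
  - by exists y; apply: lim_ext => i /=; rewrite pE.
  - have [x xE] := alim (lim_map r (lim_map qR y)).
    exists (y - x); rewrite raddfB xE; apply: lim_ext => i.
    by rewrite -[RHS]/(s i (qS i (lim_proj y i))) -pE sE.
  - have [x xE] := alim (lim_map r y).
    exists (- x); rewrite raddfN xE; apply: lim_ext => i.
    by rewrite /= sE /= addrAC subrr sub0r.
  - by exists 0; rewrite raddf0; apply: lim_ext => i; rewrite /= ps subrr.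
apply: zmod_iso_trans (Lcok_shift n ukq I0inj) _.
apply: zmod_iso_trans _ (zmod_iso_sym (Lcok_shift n uq I0inj)).
apply: Lcok_stable; exists p, s; split.
  (* [s p - id = - a r], with [- a] written as [a - a - a]. *)
  exists Q, r, (nt_sub (nt_sub a a) a); split=> // i x.
  by rewrite /= sE /= subrr sub0r addrAC subrr sub0r.
(* [p s - id] is zero, here factored through [Q] by a zero second map. *)
exists Q, (nt_comp s r), (nt_sub (nt_comp a p) (nt_comp a p)); split=> // i x.
by rewrite /= ps !subrr.
Qed.

(** [I / F] is a cosyzygy of [F], and [0 -> E / F -> I / F -> Q -> 0] satisfies the conditions of
    [Lcok_injective_quotient]. *)
Lemma Lcok_acyclic n F E I Q (m : nattrans F E) (e : nattrans E I)
    (w : nattrans I Q) :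
  mono m -> short_exact e w -> injective_object I -> injective_object Q ->
  (forall y, exists x, lim_map w x = y) ->
  zmod_iso (Lcok n (coker_functor m)) (Lcok n.+1 F).
Proof.
move=> minj ew Iinj Qinj wlim.
have meinj : mono (nt_comp m e) by move=> i x y /(se_mono ew) /minj.
have mq := coker_short_exact minj; have meq := coker_short_exact meinj.
set q := coker_proj m in mq; set p := coker_proj (nt_comp m e) in meq.
have [|k kE] := @nt_factor_exact _ _ _ _ _ _ (nt_comp e p) mq.
  by move=> i x; exact: (se_comp _ meq).
have [|v vE] := @nt_factor_exact _ _ _ _ _ _ w meq.
  by move=> i x; exact: (se_comp _ ew).
have kv : short_exact k v.
  split=> [i|i y|i y].
  - apply: raddf_inj => y; have [x <-] := se_epi mq y.
    rewrite kE => /(se_exact meq)[z /(se_mono ew) <-]; exact: (se_comp _ mq).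
  - have [x <-] := se_epi meq y; rewrite vE (se_exact ew).
    split=> [[z <-]|[z zE]]; first by exists (q i z); rewrite kE.
    have [t tE] := se_epi mq z; rewrite -tE kE in zE.
    (* [x] and [e t] differ by an element of [F], which [e] also reaches, through [m]. *)
    have : p i (x - e i t) = 0 by rewrite raddfB -zE /= subrr.
    move=> /(se_exact meq)[z' /(congr1 (+%R^~ (e i t)))].
    by rewrite subrK /= -raddfD => <-; eexists.
  - by have [x <-] := se_epi ew y; exists (p i x).
apply: zmod_iso_trans (Lcok_injective_quotient n kv Qinj _) _.
  move=> y; have [x <-] := wlim y; exists (lim_map p x).
  by apply: lim_ext => i /=; rewrite vE.
exact: zmod_iso_sym (Lcok_shift n meq Iinj).
Qed.

(** * Coinduced functors, right adjoint to forgetting the arrows *)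

Definition coind_obj (A : C -> zmodType) (i : C) : Type :=
  forall k : C, (i <= k)%O -> A k.

Section CoinducedZmodule.
Variables (A : C -> zmodType) (i : C).
Implicit Types g h : coind_obj A i.

HB.instance Definition _ := gen_eqMixin (coind_obj A i).
HB.instance Definition _ := gen_choiceMixin (coind_obj A i).

Lemma coind_ext g h : (forall k ik, g k ik = h k ik) -> g = h.
Proof.
move=> gh; apply: functional_extensionality_dep => k.
exact: functional_extensionality_dep.
Qed.

Definition coind_zero : coind_obj A i := fun _ _ => 0.
Definition coind_opp g : coind_obj A i := fun k ik => - g k ik.
Definition coind_add g h : coind_obj A i := fun k ik => g k ik + h k ik.

Fact coind_addA : associative coind_add.
Proof. by move=> x y z; apply: coind_ext => k ik; exact: addrA. Qed.
Fact coind_addC : commutative coind_add.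
Proof. by move=> x y; apply: coind_ext => k ik; exact: addrC. Qed.
Fact coind_add0 : left_id coind_zero coind_add.
Proof. by move=> x; apply: coind_ext => k ik; exact: add0r. Qed.
Fact coind_addN : left_inverse coind_zero coind_opp coind_add.
Proof. by move=> x; apply: coind_ext => k ik; exact: addNr. Qed.
HB.instance Definition _ := GRing.isZmodule.Build (coind_obj A i)
  coind_addA coind_addC coind_add0 coind_addN.

End CoinducedZmodule.

Lemma coind_irrel (A : C -> zmodType) i (g : coind_obj A i) k (ik ik' : (i <= k)%O) :
  g k ik = g k ik'.
Proof. by congr g; exact: bool_irrelevance. Qed.

Lemma coind_at (A : C -> zmodType) i (g h : coind_obj A i) k (ik : (i <= k)%O) :
  g = h -> g k ik = h k ik.
Proof. by move=> ->. Qed.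

Definition coind_map (A : C -> zmodType) i j (ij : (i <= j)%O)
    (g : coind_obj A i) : coind_obj A j :=
  fun k jk => g k (le_trans ij jk).

Lemma coind_map_is_additive (A : C -> zmodType) i j (ij : (i <= j)%O) :
  zmod_morphism (@coind_map A i j ij).
Proof. by []. Qed.

Program Definition coind (A : C -> zmodType) : functor C :=
  @Functor _ _ (fun i => coind_obj A i : zmodType)
    (fun i j ij => additive_of (@coind_map_is_additive A i j ij)) _ _.
Next Obligation. by apply: coind_ext => k ik; exact: (coind_irrel x). Qed.
Next Obligation. by apply: coind_ext => l il; exact: (coind_irrel x). Qed.

Section CoinducedMap.
Variables (A B : C -> zmodType) (f : forall k, {additive A k -> B k}).

Lemma coind_nt_is_additive i :
  zmod_morphism (fun (g : coind A i) => (fun k ik => f k (g k ik)) : coind B i).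
Proof. by move=> x y; apply: coind_ext => k ik; exact: raddfB. Qed.

Definition coind_nt : nattrans (coind A) (coind B) :=
  nt_of coind_nt_is_additive (fun _ _ _ _ => erefl).

End CoinducedMap.

Lemma coind_short_exact (A B D : C -> zmodType) (f : forall k, {additive A k -> B k})
    (g : forall k, {additive B k -> D k}) :
  (forall k, injective (f k)) ->
  (forall k y, g k y = 0 <-> exists x, f k x = y) ->
  (forall k y, exists x, g k x = y) ->
  short_exact (coind_nt f) (coind_nt g).
Proof.
move=> finj fg gsurj; split=> i.
- move=> x y xy; apply: coind_ext => k ik; apply: finj.
  exact: (coind_at ik xy).
- move=> y; split=> [y0|[x <-]]; last first.
    by apply: coind_ext => k ik; apply/fg; exists (x k ik).
  have ex k ik : exists x, f k x = y k ik.
    by apply/fg; exact: (coind_at ik y0).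
  exists (fun k ik => projT1 (cid (ex k ik))); apply: coind_ext => k ik.
  exact: projT2 (cid (ex k ik)).
- move=> y; exists (fun k ik => projT1 (cid (gsurj k (y k ik)))).
  apply: coind_ext => k ik; exact: projT2 (cid (gsurj k (y k ik))).
Qed.

(** The limit of [coind A] is the product of all [A k]: a point is determined by its diagonal
    entries, and these lift one by one. *)
Lemma coind_lim_surj (A B : C -> zmodType) (f : forall k, {additive A k -> B k}) :
  (forall k y, exists x, f k x = y) ->
  forall y, exists x, lim_map (coind_nt f) x = y.
Proof.
move=> fsurj y; pose b k := lim_proj y k k (lexx k).
pose a k := projT1 (cid (fsurj k (b k))).
have aE k : f k (a k) = b k := projT2 (cid (fsurj k (b k))).
pose x i : coind A i := fun k _ => a k.
have xC i j (ij : (i <= j)%O) : fmap (coind A) ij (x i) = x j by [].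
exists (Lim xC); apply: lim_ext => i; apply: coind_ext => k ik /=.
rewrite aE /b -(lim_compat y ik); exact: (coind_irrel (lim_proj y i)).
Qed.

(** By adjunction a map into [coind A] is a family of homomorphisms to the [A k], read off at the
    diagonal; each extends by divisibility. *)
Lemma coind_injective (A : C -> zmodType) :
  (forall k, divisible (A k)) -> injective_object (coind A).
Proof.
move=> divA F G m a minj.
have aB k : zmod_morphism (fun x => a k x k (lexx k)).
  by move=> x y; rewrite raddfB.
have ext k := divisible_injective (additive_of (aB k)) (divA k) (minj k).
pose b k := projT1 (cid (ext k)).
have bE k x : b k (m k x) = a k x k (lexx k) := projT2 (cid (ext k)) x.
pose h i (y : G i) : coind A i := fun k ik => b k (fmap G ik y).
have hB i : zmod_morphism (h i).
  by move=> x y; apply: coind_ext => k ik; rewrite /h !raddfB.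
have hN i j (ij : (i <= j)%O) x : h j (fmap G ij x) = fmap (coind A) ij (h i x).
  apply: coind_ext => k jk.
  by rewrite /h /= /coind_map -(fmap_comp ij jk (le_trans ij jk)).
exists (nt_of hB hN) => i x; apply: coind_ext => k ik /=.
rewrite /h -nt_nat bE nt_nat; exact: (coind_irrel (a i x)).
Qed.

Section CoinducedUnit.
Variable F : functor C.

Lemma coind_unit_is_additive i :
  zmod_morphism (fun x : F i => (fun k ik => fmap F ik x) : coind F i).
Proof. by move=> x y; apply: coind_ext => k ik; exact: raddfB. Qed.

Program Definition coind_unit : nattrans F (coind F) :=
  nt_of coind_unit_is_additive _.
Next Obligation.
by apply: coind_ext => k jk; rewrite /= /coind_map -(fmap_comp ij jk (le_trans ij jk)).
Qed.

Lemma coind_unit_mono : mono coind_unit.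
Proof.
by move=> i x y /(coind_at (lexx i)) /=; rewrite !fmap_id.
Qed.

End CoinducedUnit.

(** * Embedding into divisible groups and the shift along coinduction *)

(** All functions on the dual, not only the additive ones: a power of [QZ], hence divisible. *)
Definition bidual (A : zmodType) : zmodType := {additive A -> QZ} -> QZ.

Lemma bidual_unit_is_additive (A : zmodType) :
  zmod_morphism (fun (x : A) => (fun f => f x) : bidual A).
Proof. by move=> x y; apply: funext => f; exact: raddfB. Qed.

Definition bidual_unit (A : zmodType) : {additive A -> bidual A} :=
  additive_of (@bidual_unit_is_additive A).

Lemma bidual_unit_inj (A : zmodType) : injective (bidual_unit A).
Proof.
apply: raddf_inj => x x0; apply: QZ_cogenerator => f.
by have := congr1 (fun g : bidual A => g f) x0.
Qed.

Lemma bidual_divisible (A : zmodType) : divisible (bidual A).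
Proof.
move=> n y n0; have [x xE] := choice (fun f => QZ_divisible (y f) n0).
exists x; apply: funext => f; rewrite -xE.
have evB : zmod_morphism (fun g : bidual A => g f) by [].
exact: (raddfMn (additive_of evB)).
Qed.

Lemma coker_divisible (A B : zmodType) (f : {additive A -> B}) :
  divisible B -> divisible (coker f).
Proof.
move=> divB n y n0; have [z <-] := coker_pi_surj y.
by have [x <-] := divB n z n0; exists (coker_pi f x); rewrite raddfMn.
Qed.

Lemma Lcok_coind n F : zmod_iso (Lcok n (coker_functor (coind_unit F))) (Lcok n.+1 F).
Proof.
apply: (@Lcok_acyclic n F (coind F) (coind (bidual \o F))
  (coind (fun k => coker (bidual_unit (F k)))) (coind_unit F)
  (coind_nt (fun k => bidual_unit (F k)))
  (coind_nt (fun k => coker_pi (bidual_unit (F k))))).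
- exact: coind_unit_mono.
- apply: coind_short_exact => k; first exact: bidual_unit_inj.
    exact: coker_pi_eq0.
  exact: coker_pi_surj.
- by apply: coind_injective => k; exact: bidual_divisible.
- by apply: coind_injective => k; apply: coker_divisible; exact: bidual_divisible.
- by apply: coind_lim_surj => k; exact: coker_pi_surj.
Qed.

Fixpoint coind_syzygy F n : functor C :=
  if n is k.+1 then coker_functor (coind_unit (coind_syzygy F k)) else F.

(** Each coinduced syzygy trades for one cohomological degree. *)
Lemma Lcok_coind_syzygy n m F : zmod_iso (Lcok n (coind_syzygy F m)) (Lcok (m + n) F).
Proof.
elim: m n => [|m IH] n; first exact: zmod_iso_refl.
by apply: zmod_iso_trans (Lcok_coind n _) _; rewrite addSnnS; exact: IH.
Qed.

(** * Freeness of the syzygies and the theorem *)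

(** Subtracting from each coordinate the image of the coordinate at [i] has the image of the unit as
    kernel, so the cokernel is the finite product of the [F k] over [k > i]. *)
Lemma coind_coker_free F i : finite_set [set k | (i <= k)%O] ->
  (forall k, free_fin (F k)) -> free_fin (coker_functor (coind_unit F) i).
Proof.
move=> /finite_seqP[s sE] Ffree.
have sP k : (i <= k)%O = (k \in s).
  have : [set k | (i <= k)%O] k = [set` s] k by rewrite sE.
  by move=> /= e; apply/idP/idP; rewrite e.
pose T k := projT1 (cid (Ffree k)).
have phiP k : {phi : {additive F k -> (T k -> int)} | bijective phi}.
  exact: cid (projT2 (cid (Ffree k))).
pose phi k := sval (phiP k).
have [psi psiK] : exists psi : forall k, (T k -> int) -> F k,
    forall k, cancel (psi k) (phi k).
  have ex k : exists p : (T k -> int) -> F k, cancel p (phi k).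
    by case: (svalP (phiP k)) => p _ pK; exists p.
  by exists (fun k => projT1 (cid (ex k))) => k; exact: projT2 (cid (ex k)).
have phi0 k x : phi k x = 0 -> x = 0.
  by move=> x0; apply: (bij_inj (svalP (phiP k))); rewrite raddf0.
pose s' := [seq k <- s | k != i].
have le_s' (k : seq_sub s') : (i <= val k)%O.
  by have := valP k; rewrite mem_filter -sP => /andP[].
pose h (g : coind F i) (t : {k : seq_sub s' & T (val k)}) : int :=
  phi (val (tag t)) (g _ (le_s' (tag t)) - fmap F (le_s' (tag t)) (g i (lexx i)))
    (tagged t).
have hB : zmod_morphism h.
  move=> x y; apply: funext => t; rewrite /h.
  rewrite -[RHS]/((phi _ _ - phi _ _) (tagged t)) -raddfB.
  congr (phi _ _ _); rewrite raddfB !opprB addrACA [RHS]addrACA.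
  by congr (_ + _); exact: addrC.
apply: free_fin_iso (_ : zmod_iso _ ({k : seq_sub s' & T (val k)} -> int)) _; last first.
  by exists {k : seq_sub s' & T (val k)}, idfun; exists id.
apply: (@coker_iso _ _ _ _ (additive_of hB)) => [c|g] /=.
  (* The preimage is zero at [i], so no correction term arises. *)
  pose g : coind F i := fun k _ =>
    if pselect (k \in s') is left ks then
      psi k (fun t => c (existT _ (SeqSub ks) t)) else 0.
  exists g; apply: funext => -[[k ks] t]; rewrite /h /g /=.
  case: (pselect (i \in s')) => [is'|_].
    by exfalso; move: is'; rewrite mem_filter eqxx.
  rewrite raddf0 subr0; case: (pselect (k \in s')) => // ks'.
  by rewrite psiK (bool_irrelevance ks' ks).
split=> [g0|[x <-]]; last first.
  apply: funext => t; rewrite /h /= -(fmap_comp (lexx i) (le_s' _) (le_s' _)).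
  by rewrite subrr raddf0.
exists (g i (lexx i)); apply: coind_ext => k ik /=.
have [ki|ki] := eqVneq k i.
  by case: _ / (esym ki) ik => ik; rewrite fmap_id; exact: (coind_irrel g).
have ks : k \in s' by rewrite mem_filter ki -sP.
apply/esym/eqP; rewrite -subr_eq0; apply/eqP/phi0; apply: funext => t.
have := congr1 (fun u : _ -> int => u (existT _ (SeqSub ks) t)) g0.
by rewrite /h /= (bool_irrelevance (le_s' (SeqSub ks)) ik).
Qed.

End Functors.

(** Objects above [i] have degree at most [deg i], leaving finitely many finite layers. *)
Lemma up_set_finite (disp : Order.disp_t) (C : porderType disp)
    (deg : C -> nat) (i : C) : standing_assumptions deg ->
  finite_set [set k | (i <= k)%O].
Proof.
move=> hC; apply: (@sub_finite_set _ _ (\bigcup_(n in `I_(deg i).+1) up deg i n)).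
  move=> k /= ik; exists (deg k) => //=; rewrite ltnS.
  move: ik; rewrite le_eqVlt => /predU1P[->//|ik].
  exact: ltnW (deg_lt (decreasing_deg hC) ik).
apply: bigcup_finite => [|n _]; first exact: finite_II.
exact: up_finite hC _ _.
Qed.

Theorem proposition18 (disp : Order.disp_t) (C : porderType disp)
    (deg : C -> nat) (hC : standing_assumptions deg)
    (J : C -> nat -> set C) (hJ : covering_family deg J)
    (hJa : adequate deg J) :
  exists F : nat -> functor C,
    [/\ F 0%N = const_functor int,
        forall n i, free_abelian (F n i)
      & forall j : nat, (1 <= j)%N ->
          zmod_iso (Rlim j (const_functor (C := C) int)) (Rlim 1 (F j.-1))].
Proof.
exists (coind_syzygy (const_functor int)); split=> // [n i|[//|n] _].
  apply: free_fin_free; elim: n i => [|n IH] i; first exact: free_fin_int.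
  exact: coind_coker_free (up_set_finite i hC) IH.
(* With [j = n+1], both sides become [Lcok]: index [n] for the constant functor, index [0] for its
   [n]-th syzygy. *)
apply: zmod_iso_trans (Rlim_Lcok n _) _.
apply: zmod_iso_sym; apply: zmod_iso_trans (Rlim_Lcok 0 _) _.
have := Lcok_coind_syzygy 0 n (const_functor (C := C) int).
by rewrite addn0.
Qed.
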